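(* Let $\beta\ge1$. There exists a constant $c(\beta)>0$ such that the following holds. Let $x=(x_n)_{n\ge1}\in \ell^2(\mathbb{R})$ with $x_n\ge0$ for all $n\ge1$, and let $X=(X_n)_{n\ge1}$ be the unique weak solution of the inviscid dyadic system $$\dot X_n = k_{n-1}X_{n-1}^2-k_nX_nX_{n+1},\qquad X_n(0)=x_n,\qquad n\ge1,\ t\ge0,$$ with initial condition $x$. Then for all $t>0$ $$\sup_{n\ge1}k_n^{\frac13-\frac1{3\beta}}X_n(t)\le c(\beta)\,\|x\|^{\frac23}\,t^{-1/3}.$$
   Context: Conventions: $k_n=2^{\beta n}$ for $n\ge1$, $k_0=0$ and $X_0\equiv0$; $\|\cdot\|$ is the usual norm of $\ell^2(\mathbb{R})$. A weak solution is a sequence $X=(X_n)_{n\ge1}$ of real-valued differentiable functions on $[0,\infty)$ satisfying the system (equations and initial conditions) for all $n\ge1$ and $t\ge0$. For $x\in\ell^2$ with non-negative components the weak solution exists and is unique. *)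

(* Defs.v *)
From Stdlib Require Import Reals.
From Coquelicot Require Import Coquelicot.
Open Scope R_scope.

(* Sequences (x_n)_{n >= 1} are encoded as functions on [nat]; the value of an
   initial datum at index 0 is never used. *)

Definition k (beta : R) (n : nat) : R :=
  match n with
  | O => 0
  | S _ => Rpower 2 (beta * INR n)
  end.

Definition in_l2 (x : nat -> R) : Prop :=
  ex_series (fun m : nat => x (S m) ^ 2).

Definition l2_norm (x : nat -> R) : R :=
  sqrt (Series (fun m : nat => x (S m) ^ 2)).

(* [Rpower 0 p] is 1 (since [ln 0 = 0]), so for a base that may vanish the
   value 0 ^ p = 0 (p > 0) has to be put in by hand. *)
Definition rpow (a p : R) : R :=
  if Req_EM_T a 0 then 0 else Rpower a p.

(* [D_in] is the derivative relative to a domain: two-sided at t > 0 and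
   one-sided at t = 0; [X n] is unconstrained on negative times. *)
Definition weak_solution (beta : R) (x : nat -> R) (X : nat -> R -> R) : Prop :=
  (forall t : R, 0 <= t -> X 0%nat t = 0) /\
  forall n : nat, (1 <= n)%nat ->
    X n 0 = x n /\
    forall t : R, 0 <= t ->
      D_in (X n)
        (fun s : R => k beta (n - 1) * X (n - 1)%nat s ^ 2
                      - k beta n * X n s * X (n + 1)%nat s)
        (fun s : R => 0 <= s) t.

(* Main.v *)
Require Import Defs.
From Stdlib Require Import Reals Lra Lia Psatz.
From Coquelicot Require Import Coquelicot.
Open Scope R_scope.

(** The proof rests on two structural facts.  The system is a contraction for
    the norm whose square is the sum of 2^{-n} X_n^2, and it is quadratic, so
    that l X(l t) is again a solution for every l > 0.

    Contraction ([contraction]).  For the difference Z and the sum W of two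
    non-negative solutions, the interaction terms of the weighted energy of Z
    telescope and leave non-positive terms and a boundary term
    2^{-n} k_n Z_n Z_{n+1} W_n.  The latter vanishes in the limit because the
    time integrals of k_n X_n^3 are bounded uniformly in n
    ([cube_int_bounded]): this integral appears in the derivative of
    X_n X_{n+1}, and it is controlled by the energy and by a small multiple of
    the same integrals at shells n + 1 and n + 2.

    Speed ([speed_bound]).  Comparing X(t) with l X(l t) as l tends to 1 bounds
    X_n + t X_n' in the weighted norm.  Hence t |X_n'(t)| is at most a multiple
    of 2^n |x|.

    Pointwise bound ([weighted_cube_bound]).  The equations now become
    inequalities between the values at one fixed time t.  Put B = |x|^2 / t and
    Y_n = k_n^{1/3 - 1/(3 beta)} X_n.  The energy balance bounds Y_n^2 Y_{n+1}
    by a multiple of B, and the equation of shell n + 1 bounds Y_n^3 by a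
    multiple of B plus 2 Y_n Y_{n+1} Y_{n+2}.  If Y_n^3 exceeded a suitable
    multiple of B, the two would give X_{n+2} >= 2 X_n with Y_{n+2} >= Y_n, so
    the same would hold at shell n + 2, and so on: the X_n would be unbounded,
    although the energy does not increase.  Thus Y_n is at most a constant times
    B^{1/3}. *)

(** * Differential calculus on the half-line *)

(** A solution is differentiable only from the right at time 0.  Extending it
    by its initial value to negative times makes it continuous on the whole
    line, so that integrals and the mean value theorem apply down to 0 although
    the equation is read at positive times only. *)
Definition diff_from_0 (f f' : R -> R) : Prop :=
  (forall t, continuous f t) /\ (forall t, 0 < t -> is_derive f t (f' t)).

Lemma diff_plus f f' g g' :
  diff_from_0 f f' -> diff_from_0 g g' ->
  diff_from_0 (fun t => f t + g t) (fun t => f' t + g' t).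
Proof.
intros [cf df] [cg dg]; split.
- intro t; apply (continuous_plus f g t); auto.
- intros t Ht; apply (is_derive_plus f g t); auto.
Qed.

Lemma diff_mult f f' g g' :
  diff_from_0 f f' -> diff_from_0 g g' ->
  diff_from_0 (fun t => f t * g t) (fun t => f' t * g t + f t * g' t).
Proof.
intros [cf df] [cg dg]; split.
- intro t; apply (continuous_mult f g t); auto.
- intros t Ht; apply (is_derive_mult f g t); auto using Rmult_comm.
Qed.

Lemma diff_scal c f f' :
  diff_from_0 f f' -> diff_from_0 (fun t => c * f t) (fun t => c * f' t).
Proof.
intros [cf df]; split.
- intro t; apply (continuous_scal_r c f t); auto.
- intros t Ht; apply (is_derive_scal f t c); auto.
Qed.

Lemma diff_ext f f' g g' :
  (forall t, f t = g t) -> (forall t, 0 < t -> f' t = g' t) ->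
  diff_from_0 f f' -> diff_from_0 g g'.
Proof.
intros e e' [cf df]; split.
- intro t; apply (continuous_ext f); auto.
- intros t Ht; apply (is_derive_ext f); auto. rewrite <- e' by auto; auto.
Qed.

Lemma diff_comp_exp f f' :
  diff_from_0 f f' ->
  diff_from_0 (fun t => exp (f t)) (fun t => f' t * exp (f t)).
Proof.
intros [cf df]; split.
- intro t; apply (continuous_comp f exp); auto.
  apply continuity_pt_filterlim, derivable_continuous_pt, derivable_pt_exp.
- intros t Ht; apply (is_derive_comp exp f t); auto.
  apply is_derive_Reals, derivable_pt_lim_exp.
Qed.

Lemma diff_RInt g :
  (forall t, continuous g t) ->
  diff_from_0 (fun t => RInt g 0 t) g.
Proof.
intro cg.
assert (d : forall t, is_derive (fun t => RInt g 0 t) t (g t)).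
{ intro t; apply (is_derive_RInt g (fun t => RInt g 0 t) 0); auto.
  apply filter_forall; intro s.
  apply (RInt_correct g 0 s), (ex_RInt_continuous g); auto. }
split; auto.
intro t; apply (ex_derive_continuous (fun t => RInt g 0 t)).
eexists; apply d.
Qed.

Lemma diff_nonneg_increasing f f' T :
  diff_from_0 f f' -> (forall t, 0 <= t -> 0 <= f' t) -> 0 <= T ->
  f 0 <= f T.
Proof.
intros [cf df] pos HT.
destruct (MVT_gen f 0 T f') as [c [Hc e]].
- rewrite Rmin_left by auto; intros; apply df; lra.
- intros; apply continuity_pt_filterlim, cf.
- rewrite Rmin_left in Hc by auto.
  assert (0 <= f' c) by (apply pos; lra).
  nra.
Qed.

(** Integrating factor: the function multiplied by the exponential of the
    primitive of p has derivative g times that exponential. *)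
Lemma diff_linear_nonneg u p g :
  diff_from_0 u (fun t => g t - p t * u t) ->
  (forall t, continuous p t) -> (forall t, 0 <= t -> 0 <= g t) ->
  0 <= u 0 -> forall t, 0 <= t -> 0 <= u t.
Proof.
intros du cp pg u0 t Ht.
pose proof (diff_mult _ _ _ _ du (diff_comp_exp _ _ (diff_RInt p cp))) as d.
assert (h := diff_nonneg_increasing _ _ t d).
cbv beta in h.
rewrite RInt_point in h.
assert (0 < exp (RInt p 0 t)) by apply exp_pos.
change (@zero R_CompleteNormedModule) with 0 in h.
rewrite exp_0 in h.
assert (h' : 0 <= u t * exp (RInt p 0 t)).
{ apply Rle_trans with (u 0 * 1); [lra | apply h; auto].
  intros s Hs.
  replace (_ + _) with (g s * exp (RInt p 0 s)) by ring.
  apply Rmult_le_pos; [auto | left; apply exp_pos]. }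
apply Rmult_le_reg_r with (exp (RInt p 0 t)); lra.
Qed.

(** * Positivity and energy of the shells *)

Lemma k_pow b n : k b (S n) = Rpower 2 b ^ S n.
Proof.
unfold k. rewrite <- Rpower_pow by apply exp_pos.
now rewrite Rpower_mult.
Qed.

Lemma k_pos b n : 0 < k b (S n).
Proof. apply exp_pos. Qed.

Lemma k_nonneg b n : 0 <= k b n.
Proof. destruct n; [simpl; lra | left; apply k_pos]. Qed.

Lemma k_succ b n : k b (S (S n)) = Rpower 2 b * k b (S n).
Proof. now rewrite !k_pow. Qed.

(** The working form of a weak solution with non-negative data.  Since k b 0
    is 0, the case n = 0 is the equation of the first, unforced, shell. *)
Definition flow (b : R) (X : nat -> R -> R) : Prop :=
  forall n, 0 <= X (S n) 0 /\
    diff_from_0 (X (S n))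
      (fun t => k b n * X n t ^ 2 - k b (S n) * X (S n) t * X (S (S n)) t).

(** The index n means the first n + 1 shells. *)
Definition energy (X : nat -> R -> R) (n : nat) (t : R) : R :=
  sum_f_R0 (fun j => X (S j) t ^ 2) n.

Lemma flow_nonneg b X n t : flow b X -> 0 <= t -> 0 <= X (S n) t.
Proof.
intros F Ht.
destruct (F n) as [p d]; destruct (F (S n)) as [_ [c _]].
apply (diff_linear_nonneg (X (S n)) (fun t => k b (S n) * X (S (S n)) t)
  (fun t => k b n * X n t ^ 2)); auto.
- revert d; apply diff_ext; intros; ring.
- intro s; apply (continuous_scal_r (k b (S n)) (X (S (S n)))); auto.
- intros s _; apply Rmult_le_pos; [apply k_nonneg | apply pow2_ge_0].
Qed.

(** The transfers between neighbouring shells telescope, and only the flux out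
    of the last shell remains. *)
Lemma energy_diff b X n : flow b X ->
  diff_from_0 (energy X n)
    (fun t => - 2 * (k b (S n) * X (S n) t ^ 2 * X (S (S n)) t)).
Proof.
intro F; induction n as [|n IH]; unfold energy; simpl sum_f_R0.
- destruct (F 0%nat) as [_ d].
  generalize (diff_mult _ _ _ _ d d).
  apply diff_ext; intros; simpl; ring.
- destruct (F (S n)) as [_ d].
  generalize (diff_plus _ _ _ _ IH (diff_mult _ _ _ _ d d)).
  apply diff_ext; intros; unfold energy; simpl; ring.
Qed.

Lemma energy_decr b X n t : flow b X -> 0 <= t ->
  energy X n t <= energy X n 0.
Proof.
intros F Ht.
assert (h := diff_nonneg_increasing _ _ t
  (diff_scal (-1) _ _ (energy_diff b X n F))).
cbv beta in h.
enough (-1 * energy X n 0 <= -1 * energy X n t) by lra.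
apply h; auto.
intros s Hs.
assert (0 <= k b (S n) * X (S n) s ^ 2 * X (S (S n)) s); [|lra].
apply Rmult_le_pos; [apply Rmult_le_pos|].
- apply k_nonneg.
- apply pow2_ge_0.
- apply (flow_nonneg b); auto.
Qed.

Lemma energy_nonneg X n t : 0 <= energy X n t.
Proof. apply cond_pos_sum; intro; apply pow2_ge_0. Qed.

Lemma flow_bounded b X M n t : flow b X -> 0 <= M ->
  (forall n, energy X n 0 <= M ^ 2) -> 0 <= t ->
  0 <= X (S n) t <= M.
Proof.
intros F HM HE Ht.
assert (p := flow_nonneg b X n t F Ht).
split; auto.
apply Rsqr_incr_0; auto.
rewrite !Rsqr_pow2.
apply Rle_trans with (energy X n t).
- destruct n; unfold energy; simpl sum_f_R0; [apply Rle_refl|].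
  change (X (S (S n)) t ^ 2 <= energy X n t + X (S (S n)) t ^ 2).
  assert (h := energy_nonneg X n t); lra.
- apply Rle_trans with (energy X n 0); [now apply (energy_decr b) | apply HE].
Qed.

(** * A bound on the time integral of k_n X_n^3, uniform in n *)

Lemma cube_continuous b X n : flow b X ->
  forall t, continuous (fun t => k b (S n) * X (S n) t ^ 3) t.
Proof.
intros F t.
destruct (F n) as [_ [c _]].
apply (continuous_scal_r (k b (S n)) (fun t => X (S n) t ^ 3)).
apply (continuous_ext (fun t => X (S n) t * (X (S n) t * X (S n) t))).
{ intro; simpl; ring. }
repeat apply (continuous_mult (K := R_AbsRing)); auto.
Qed.

Definition cube_int b (X : nat -> R -> R) n T :=
  RInt (fun t => k b (S n) * X (S n) t ^ 3) 0 T.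

Lemma cube_int_diff b X n : flow b X ->
  diff_from_0 (cube_int b X n) (fun t => k b (S n) * X (S n) t ^ 3).
Proof. intro F; apply diff_RInt, cube_continuous, F. Qed.

Lemma cube_int_0 b X n : cube_int b X n 0 = 0.
Proof. apply (RInt_point (V := R_CompleteNormedModule)). Qed.

Lemma sq_mul_le_cubes x z : 0 <= x -> 0 <= z -> x ^ 2 * z <= x ^ 3 + z ^ 3.
Proof.
intros Hx Hz; destruct (Rle_lt_dec x z).
- assert (0 <= x ^ 3) by (now apply pow_le).
  assert (x ^ 2 <= z ^ 2) by (apply pow_incr; lra). nra.
- assert (0 <= z ^ 3) by (now apply pow_le).
  assert (0 <= x ^ 2) by (apply pow2_ge_0). nra.
Qed.

(** The two products produced by differentiating X_n X_{n+1}, split into a small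
    multiple of cubes and a multiple of energy fluxes, whose time integrals are
    controlled by the energy. *)
Lemma young_cubic eps x y z : 0 < eps -> 0 <= x -> 0 <= y -> 0 <= z ->
  x * y ^ 2 <= eps * y ^ 3 + / (4 * eps) * (x ^ 2 * y) /\
  x * y * z <= eps * (x ^ 3 + z ^ 3) + / (4 * eps) * (y ^ 2 * z).
Proof.
intros He Hx Hy Hz.
assert (amgm : forall a c, a * c <= eps * a ^ 2 + / (4 * eps) * c ^ 2).
{ intros a c.
  enough (0 <= / (4 * eps) * (2 * eps * a - c) ^ 2).
  { replace (/ (4 * eps) * (2 * eps * a - c) ^ 2) with
      (eps * a ^ 2 + / (4 * eps) * c ^ 2 - a * c) in H by (field; lra); lra. }
  apply Rmult_le_pos; [|apply pow2_ge_0].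
  left; apply Rinv_0_lt_compat; lra. }
assert (mix := sq_mul_le_cubes x z Hx Hz).
split.
- apply Rle_trans with ((eps * y ^ 2 + / (4 * eps) * x ^ 2) * y).
  + replace (x * y ^ 2) with (y * x * y) by ring.
    apply Rmult_le_compat_r; auto.
  + apply Req_le; ring.
- apply Rle_trans with ((eps * x ^ 2 + / (4 * eps) * y ^ 2) * z).
  + apply Rmult_le_compat_r; auto.
  + assert (eps * (x ^ 2 * z) <= eps * (x ^ 3 + z ^ 3))
      by (apply Rmult_le_compat_l; lra).
    lra.
Qed.

Lemma le_of_geometric_slack u D G n : 0 <= G ->
  (forall m, (n <= m)%nat -> u <= D + G * (1 / 2) ^ m) -> u <= D.
Proof.
intros HG H.
destruct (Rle_lt_dec u D) as [|lt]; auto; exfalso.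
destruct (pow_lt_1_zero (1 / 2)) with (y := (u - D) / (G + 1)) as [N HN].
- rewrite Rabs_right; lra.
- apply Rdiv_lt_0_compat; lra.
- specialize (HN (n + N)%nat ltac:(lia)); specialize (H (n + N)%nat ltac:(lia)).
  rewrite Rabs_right in HN by (apply Rle_ge, pow_le; lra).
  apply Rlt_div_r in HN; [|lra].
  assert (0 <= (1 / 2) ^ (n + N)) by (apply pow_le; lra).
  lra.
Qed.

(** Each use of the recursion halves the geometric part of the a priori bound
    and keeps the constant part below 2 C. *)
Lemma backward_bound (a : nat -> R) (C D r d : R) :
  0 <= C -> 0 <= D -> 1 <= r -> 0 <= d -> d * (r + r ^ 2) <= 1 / 2 ->
  (forall n, a n <= D * r ^ n) ->
  (forall n, a n <= C + d * (a (S n) + a (S (S n)))) ->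
  forall n, a n <= 2 * C.
Proof.
intros HC HD Hr Hd small apriori rec.
assert (halve : forall j n, a n <= 2 * C + D * (1 / 2) ^ j * r ^ n).
{ induction j as [|j IH]; intro n.
  - specialize (apriori n); simpl pow; lra.
  - assert (h := rec n).
    assert (h1 := IH (S n)); assert (h2 := IH (S (S n))).
    set (w := D * (1 / 2) ^ j * r ^ n) in *.
    assert (0 <= w).
    { unfold w; repeat apply Rmult_le_pos; auto; apply pow_le; lra. }
    replace (D * (1 / 2) ^ j * r ^ S n) with (r * w) in h1
      by (unfold w; simpl; ring).
    replace (D * (1 / 2) ^ j * r ^ S (S n)) with (r ^ 2 * w) in h2
      by (unfold w; simpl; ring).
    replace (D * (1 / 2) ^ S j * r ^ n) with (w / 2)
      by (unfold w; simpl; field).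
    assert (d * (a (S n) + a (S (S n))) <= d * (4 * C + (r + r ^ 2) * w))
      by (apply Rmult_le_compat_l; lra).
    assert (2 <= r + r ^ 2) by nra.
    assert (d <= 1 / 4) by nra.
    assert (d * (r + r ^ 2) * w <= 1 / 2 * w) by (apply Rmult_le_compat_r; lra).
    nra. }
intro n.
apply (le_of_geometric_slack _ _ (D * r ^ n) 0).
- apply Rmult_le_pos; auto; apply pow_le; lra.
- intros j _; specialize (halve j n); lra.
Qed.

(** The derivative of X_n X_{n+1} contains k_n X_n^3, and its other terms are
    handled by Young's inequality.  Energies stand for the integrated fluxes
    that appear, so that the estimate is the monotonicity of one combination of
    X_n X_{n+1}, cube integrals and energies.  The coefficient of the later
    integrals is small enough for the a priori growth r^n to be absorbed. *)
Lemma cube_int_recursion b X M T n : 1 <= Rpower 2 b -> flow b X -> 0 <= M ->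
  (forall n, energy X n 0 <= M ^ 2) -> 0 <= T ->
  let r := Rpower 2 b in
  cube_int b X n T <=
    (2 + 8 * r ^ 2) * M ^ 2 +
    / (4 * r ^ 2) * (cube_int b X (S n) T + cube_int b X (S (S n)) T).
Proof.
intros Hr F HM HE HT r.
fold r in Hr.
(* Any parameter with 2 e (r + r^2) <= 1/2 lets the recursion be iterated. *)
set (e := / (8 * r ^ 2)).
assert (r2 : 1 <= r ^ 2) by nra.
assert (He : 0 < e) by (apply Rinv_0_lt_compat; lra).
assert (e4 : / (4 * e) = 2 * r ^ 2) by (unfold e; field; lra).
assert (er : r * e <= 1 / 2).
{ unfold e; apply Rmult_le_reg_r with (8 * r ^ 2); [lra|].
  replace (r * / (8 * r ^ 2) * (8 * r ^ 2)) with r by (field; lra); nra. }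
destruct (F n) as [p0 d0]; destruct (F (S n)) as [p1 d1].
pose proof (diff_plus _ _ _ _ (diff_mult _ _ _ _ d0 d1)
  (diff_plus _ _ _ _ (diff_scal (- (1 / 2)) _ _ (cube_int_diff b X n F))
  (diff_plus _ _ _ _ (diff_scal e _ _ (cube_int_diff b X (S n) F))
  (diff_plus _ _ _ _ (diff_scal e _ _ (cube_int_diff b X (S (S n)) F))
  (diff_plus _ _ _ _ (diff_scal (- r ^ 2) _ _ (energy_diff b X n F))
  (diff_scal (- r ^ 2) _ _ (energy_diff b X (S n) F))))))) as d.
assert (h := diff_nonneg_increasing _ _ T d).
cbv beta in h; rewrite !cube_int_0 in h.
assert (E0 := HE n); assert (E1 := HE (S n)).
assert (E2 := energy_nonneg X n T); assert (E3 := energy_nonneg X (S n) T).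
destruct (flow_bounded b X M n T F HM HE HT).
destruct (flow_bounded b X M (S n) T F HM HE HT).
assert (X (S n) T * X (S (S n)) T <= M ^ 2) by nra.
assert (0 <= X (S n) 0 * X (S (S n)) 0) by (now apply Rmult_le_pos).
assert (hyp : X (S n) 0 * X (S (S n)) 0 + (- (1 / 2) * 0 + (e * 0 + (e * 0 +
    (- r ^ 2 * energy X n 0 + - r ^ 2 * energy X (S n) 0)))) <=
    X (S n) T * X (S (S n)) T + (- (1 / 2) * cube_int b X n T +
    (e * cube_int b X (S n) T + (e * cube_int b X (S (S n)) T +
    (- r ^ 2 * energy X n T + - r ^ 2 * energy X (S n) T))))).
{ apply h; auto.
  intros t Ht.
  assert (x0 := flow_nonneg b X n t F Ht).
  assert (x1 := flow_nonneg b X (S n) t F Ht).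
  assert (x2 := flow_nonneg b X (S (S n)) t F Ht).
  rewrite !k_succ; fold r.
  set (kn := k b (S n)).
  assert (Hk : 0 < kn) by apply k_pos.
  assert (Hk' := k_nonneg b n).
  set (x := X (S n) t) in *; set (y := X (S (S n)) t) in *;
  set (z := X (S (S (S n))) t) in *; set (v := k b n * X n t ^ 2).
  destruct (young_cubic e x y z He x0 x1 x2) as [y1 y2].
  rewrite e4 in y1, y2.
  assert (0 <= v) by (apply Rmult_le_pos; auto; apply pow2_ge_0).
  assert (0 <= v * y) by (now apply Rmult_le_pos).
  assert (k1 := Rmult_le_compat_l kn _ _ (Rlt_le _ _ Hk) y1).
  assert (k2 := Rmult_le_compat_l (kn * r) _ _ ltac:(nra) y2).
  assert (0 <= kn * x ^ 3) by (apply Rmult_le_pos; [lra | now apply pow_le]).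
  assert (0 <= kn * y ^ 3) by (apply Rmult_le_pos; [lra | now apply pow_le]).
  assert (0 <= kn * z ^ 3) by (apply Rmult_le_pos; [lra | now apply pow_le]).
  assert (s1 : r * e * (kn * x ^ 3) <= 1 / 2 * (kn * x ^ 3))
    by (apply Rmult_le_compat_r; auto).
  assert (s2 : 1 * (e * (kn * y ^ 3)) <= r * (e * (kn * y ^ 3)))
    by (apply Rmult_le_compat_r; nra).
  assert (s3 : r * (e * (kn * z ^ 3)) <= r ^ 2 * (e * (kn * z ^ 3)))
    by (apply Rmult_le_compat_r; nra).
  nra. }
replace (/ (4 * r ^ 2)) with (2 * e) by (unfold e; field; lra).
assert (r ^ 2 * energy X n 0 <= r ^ 2 * M ^ 2) by (apply Rmult_le_compat_l; lra).
assert (r ^ 2 * energy X (S n) 0 <= r ^ 2 * M ^ 2) by (apply Rmult_le_compat_l; lra).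
assert (0 <= r ^ 2 * energy X n T) by (apply Rmult_le_pos; lra).
assert (0 <= r ^ 2 * energy X (S n) T) by (apply Rmult_le_pos; lra).
assert (0 <= r ^ 2 * M ^ 2) by (apply Rmult_le_pos; [lra | apply pow2_ge_0]).
lra.
Qed.

Lemma cube_int_bounded b X M T : 1 <= Rpower 2 b -> flow b X -> 0 <= M ->
  (forall n, energy X n 0 <= M ^ 2) -> 0 <= T ->
  exists C, forall n, cube_int b X n T <= C.
Proof.
intros Hr F HM HE HT.
set (r := Rpower 2 b) in *.
exists (2 * ((2 + 8 * r ^ 2) * M ^ 2)).
assert (r2 : 1 <= r ^ 2) by nra.
assert (M3 : 0 <= M ^ 3) by (now apply pow_le).
apply (backward_bound (fun n => cube_int b X n T) _ (r * T * M ^ 3) r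
  (/ (4 * r ^ 2))); auto.
- apply Rmult_le_pos; [lra | apply pow2_ge_0].
- repeat apply Rmult_le_pos; lra.
- left; apply Rinv_0_lt_compat; lra.
- apply Rmult_le_reg_r with (4 * r ^ 2); [lra|].
  replace (/ (4 * r ^ 2) * (r + r ^ 2) * (4 * r ^ 2)) with (r + r ^ 2)
    by (field; lra).
  nra.
- intro n.
  apply Rle_trans with (RInt (fun _ => k b (S n) * M ^ 3) 0 T).
  + apply RInt_le; auto.
    * apply (ex_RInt_continuous (V := R_CompleteNormedModule)).
      intros; now apply cube_continuous.
    * apply ex_RInt_const.
    * intros t Ht.
      apply Rmult_le_compat_l; [left; apply k_pos|].
      apply pow_incr, (flow_bounded b); auto; lra.
  + rewrite RInt_const, k_pow; fold r.
    unfold scal; simpl; unfold mult; simpl.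
    apply Req_le; ring.
- intro n; now apply cube_int_recursion.
Qed.

(** * Contraction in the norm with weights 2^{-n} *)

Definition weighted_dist (X X' : nat -> R -> R) (n : nat) (t : R) : R :=
  sum_f_R0 (fun j => / 2 ^ j * (X (S j) t - X' (S j) t) ^ 2) n.

(** With Z the difference and W the sum of two solutions,
      Z_n' = k_{n-1} Z_{n-1} W_{n-1} - k_n (Z_n W_{n+1} + W_n Z_{n+1}) / 2.
    In the derivative of 2^{-n} Z_n^2 the forcing of shell n + 1 carries the
    factor 2 * 2^{-(n+1)}, which is exactly what cancels the last term of shell
    n.  Up to the boundary term, only non-positive terms are left. *)
Lemma weighted_dist_diff b X X' n : flow b X -> flow b X' ->
  diff_from_0 (weighted_dist X X' n)
    (fun t => sum_f_R0 (fun j => - / 2 ^ j * k b (S j) *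
         ((X (S j) t - X' (S j) t) ^ 2 * (X (S (S j)) t + X' (S (S j)) t))) n
       - / 2 ^ n * k b (S n) * ((X (S n) t - X' (S n) t) *
           (X (S (S n)) t - X' (S (S n)) t) * (X (S n) t + X' (S n) t))).
Proof.
intros F F'.
assert (dZ : forall j, diff_from_0
  (fun t => / 2 ^ j * (X (S j) t - X' (S j) t) ^ 2)
  (fun t => / 2 ^ j * (2 * (X (S j) t - X' (S j) t) *
    (k b j * ((X j t - X' j t) * (X j t + X' j t))
      - k b (S j) * (X (S j) t * X (S (S j)) t - X' (S j) t * X' (S (S j)) t))))).
{ intro j; destruct (F j) as [_ d]; destruct (F' j) as [_ d'].
  pose proof (diff_plus _ _ _ _ d (diff_scal (-1) _ _ d')) as e.
  generalize (diff_scal (/ 2 ^ j) _ _ (diff_mult _ _ _ _ e e)).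
  apply diff_ext; intros; ring. }
induction n as [|n IH]; unfold weighted_dist; cbn [sum_f_R0].
- generalize (dZ 0%nat); apply diff_ext; intros; [reflexivity|].
  cbv beta; change (k b 0) with 0; field.
- generalize (diff_plus _ _ _ _ IH (dZ (S n))); apply diff_ext; intros; auto.
  cbv beta; simpl pow; field. apply pow_nonzero; lra.
Qed.

(** Dominates the boundary term of the weighted distance by quantities that have
    bounded time integrals once multiplied by k_n. *)
Lemma boundary_cubic x x' y y' : 0 <= x -> 0 <= x' -> 0 <= y -> 0 <= y' ->
  - ((x - x') * (y - y') * (x + x')) <=
    4 * (x ^ 3 + y ^ 3 + (x' ^ 3 + y' ^ 3)).
Proof.
intros Hx Hx' Hy Hy'.
assert (cube : forall a c, 0 <= a -> 0 <= c -> (a + c) ^ 3 <= 4 * (a ^ 3 + c ^ 3)).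
{ intros a c Ha Hc.
  assert (0 <= (a + c) * (a - c) ^ 2)
    by (apply Rmult_le_pos; [lra | apply pow2_ge_0]).
  nra. }
assert (c1 := cube x x' Hx Hx'); assert (c2 := cube y y' Hy Hy').
assert (m := sq_mul_le_cubes (x + x') (y + y') ltac:(lra) ltac:(lra)).
enough (- ((x - x') * (y - y') * (x + x')) <= (x + x') ^ 2 * (y + y')) by lra.
assert (0 <= (x + x') * (x * y)) by (repeat apply Rmult_le_pos; lra).
assert (0 <= (x + x') * (x' * y')) by (repeat apply Rmult_le_pos; lra).
nra.
Qed.

Lemma weighted_dist_growth b X X' n T : 1 <= Rpower 2 b ->
  flow b X -> flow b X' -> 0 <= T ->
  weighted_dist X X' n T <= weighted_dist X X' n 0 +
    4 / 2 ^ n * (cube_int b X n T + cube_int b X (S n) T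
      + (cube_int b X' n T + cube_int b X' (S n) T)).
Proof.
intros Hr F F' HT.
assert (W : 0 < / 2 ^ n) by (apply Rinv_0_lt_compat, pow_lt; lra).
pose proof (diff_plus _ _ _ _
  (diff_scal (-1) _ _ (weighted_dist_diff b X X' n F F'))
  (diff_scal (4 / 2 ^ n) _ _
    (diff_plus _ _ _ _
      (diff_plus _ _ _ _ (cube_int_diff b X n F) (cube_int_diff b X (S n) F))
      (diff_plus _ _ _ _
        (cube_int_diff b X' n F') (cube_int_diff b X' (S n) F'))))) as d.
assert (h := diff_nonneg_increasing _ _ T d).
cbv beta in h; rewrite !cube_int_0 in h.
enough (-1 * weighted_dist X X' n 0 + 4 / 2 ^ n * (0 + 0 + (0 + 0)) <=
  -1 * weighted_dist X X' n T + 4 / 2 ^ n * (cube_int b X n T + cube_int b X (S n) T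
      + (cube_int b X' n T + cube_int b X' (S n) T))) by lra.
apply h; auto.
intros t Ht.
assert (pos : forall j, 0 <= X (S j) t) by (intro; now apply (flow_nonneg b)).
assert (pos' : forall j, 0 <= X' (S j) t) by (intro; now apply (flow_nonneg b)).
match goal with |- _ <= -1 * (?s - _) + _ => assert (Hs : 0 <= - s) end.
{ rewrite <- Ropp_0; apply Ropp_le_contravar.
  rewrite <- (sum_eq_R0 (fun _ => 0) n) by auto.
  apply sum_Rle; intros j _.
  assert (0 <= / 2 ^ j) by (left; apply Rinv_0_lt_compat, pow_lt; lra).
  assert (0 <= k b (S j)) by apply k_nonneg.
  rewrite Ropp_mult_distr_l_reverse, Ropp_mult_distr_l_reverse.
  rewrite <- Ropp_0; apply Ropp_le_contravar.
  apply Rmult_le_pos; [now apply Rmult_le_pos | apply Rmult_le_pos].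
  - apply pow2_ge_0.
  - specialize (pos (S j)); specialize (pos' (S j)); lra. }
match goal with |- _ <= -1 * (?s - _) + _ => set (s' := s) in * end.
assert (bc := boundary_cubic _ _ _ _ (pos n) (pos' n) (pos (S n)) (pos' (S n))).
rewrite k_succ.
set (kn := k b (S n)).
assert (Hk : 0 <= / 2 ^ n * kn)
  by (apply Rmult_le_pos; [lra | left; apply k_pos]).
apply (Rmult_le_compat_l _ _ _ Hk) in bc.
assert (c1 : 0 <= / 2 ^ n * kn * X (S (S n)) t ^ 3)
  by (apply Rmult_le_pos; auto; now apply pow_le).
assert (c2 : 0 <= / 2 ^ n * kn * X' (S (S n)) t ^ 3)
  by (apply Rmult_le_pos; auto; now apply pow_le).
assert (c3 := Rmult_le_compat_r _ _ _ c1 Hr).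
assert (c4 := Rmult_le_compat_r _ _ _ c2 Hr).
unfold Rdiv; lra.
Qed.

Lemma weighted_dist_monotone_n X X' n m t : (n <= m)%nat ->
  weighted_dist X X' n t <= weighted_dist X X' m t.
Proof.
induction 1 as [|m _ IH]; [lra|].
unfold weighted_dist in *; cbn [sum_f_R0].
assert (0 <= / 2 ^ S m * (X (S (S m)) t - X' (S (S m)) t) ^ 2); [|lra].
apply Rmult_le_pos; [|apply pow2_ge_0].
left; apply Rinv_0_lt_compat, pow_lt; lra.
Qed.

(** The boundary term contributes a bounded integral times 2^{-n}, hence nothing
    in the limit. *)
Lemma contraction b X X' M M' D n T : 1 <= Rpower 2 b ->
  flow b X -> flow b X' -> 0 <= M -> 0 <= M' ->
  (forall n, energy X n 0 <= M ^ 2) -> (forall n, energy X' n 0 <= M' ^ 2) ->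
  (forall n, weighted_dist X X' n 0 <= D) -> 0 <= T ->
  weighted_dist X X' n T <= D.
Proof.
intros Hr F F' HM HM' HE HE' HD HT.
destruct (cube_int_bounded b X M T) as [C HC]; auto.
destruct (cube_int_bounded b X' M' T) as [C' HC']; auto.
set (G := Rabs (8 * C + 8 * C') + 1).
assert (HG : 8 * C + 8 * C' < G)
  by (assert (h := Rle_abs (8 * C + 8 * C')); unfold G; lra).
assert (G0 : 0 <= G) by (assert (h := Rabs_pos (8 * C + 8 * C')); unfold G; lra).
apply (le_of_geometric_slack _ _ G n); [lra|]; intros m Hm.
apply Rle_trans with (1 := weighted_dist_monotone_n X X' n m T Hm).
apply Rle_trans with (1 := weighted_dist_growth b X X' m T Hr F F' HT).
assert (h := HD m); assert (h1 := HC m); assert (h2 := HC (S m));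
assert (h3 := HC' m); assert (h4 := HC' (S m)).
assert (W : 0 < / 2 ^ m) by (apply Rinv_0_lt_compat, pow_lt; lra).
replace ((1 / 2) ^ m) with (/ 2 ^ m)
  by (rewrite <- pow_inv; f_equal; lra).
unfold Rdiv; nra.
Qed.

(** * Scaling and the speed of the solution *)

Lemma diff_rescale l f f' : 0 < l -> diff_from_0 f f' ->
  diff_from_0 (fun t => l * f (l * t)) (fun t => l ^ 2 * f' (l * t)).
Proof.
intros Hl [cf df]; split.
- intro t; apply (continuous_scal_r l (fun t => f (l * t))).
  apply (continuous_comp (fun t => l * t) f); auto.
  apply (ex_derive_continuous (fun t => l * t)); auto_derive; auto.
- intros t Ht.
  replace (l ^ 2 * f' (l * t)) with (l * (l * f' (l * t))) by ring.
  apply (is_derive_scal (fun t => f (l * t)) t l).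
  apply (is_derive_comp f (fun t => l * t) t).
  + apply df; nra.
  + auto_derive; auto; ring.
Qed.

Lemma flow_rescale b X l : 0 < l -> flow b X ->
  flow b (fun n t => l * X n (l * t)).
Proof.
intros Hl F n; destruct (F n) as [p d]; split.
- rewrite Rmult_0_r; apply Rmult_le_pos; lra.
- generalize (diff_rescale l _ _ Hl d); apply diff_ext; intros; ring.
Qed.

Lemma derivative_bound_right f l K a :
  is_derive f a l -> (forall s, a < s -> Rabs (f s - f a) <= K * (s - a)) ->
  Rabs l <= K.
Proof.
intros d H.
destruct (Rle_lt_dec (Rabs l) K) as [|lt]; auto; exfalso.
apply is_derive_Reals in d.
destruct (d (Rabs l - K)) as [e He]; [lra|].
assert (e0 := cond_pos e).
specialize (He (e / 2)).
rewrite (Rabs_right (e / 2)) in He by lra.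
specialize (He ltac:(lra) ltac:(lra)).
specialize (H (a + e / 2) ltac:(lra)).
replace (a + e / 2 - a) with (e / 2) in H by ring.
assert (h : Rabs ((f (a + e / 2) - f a) / (e / 2)) <= K).
{ unfold Rdiv at 1; rewrite Rabs_mult, (Rabs_right (/ (e / 2)))
    by (apply Rle_ge, Rlt_le, Rinv_0_lt_compat; lra).
  apply Rmult_le_reg_r with (e / 2); [lra|].
  rewrite Rmult_assoc, Rinv_l, Rmult_1_r by lra; auto. }
assert (t := Rabs_triang_inv l ((f (a + e / 2) - f a) / (e / 2))).
rewrite Rabs_minus_sym in He. lra.
Qed.

Definition speed b (X : nat -> R -> R) n t :=
  k b n * X n t ^ 2 - k b (S n) * X (S n) t * X (S (S n)) t.

(** Together with X(t), the scaled l X(l t) is a solution, starting at l x.  By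
    contraction they stay at distance at most (l - 1) |x|, so the derivative
    X_n + t X_n' of l X_n(l t) at l = 1 is bounded.  The weight only gives the
    factor 2^{n/2}; the larger 2^n suffices and avoids half-integer powers. *)
Lemma speed_bound b X M n T : 1 <= Rpower 2 b -> flow b X -> 0 <= M ->
  (forall n, energy X n 0 <= M ^ 2) -> 0 < T ->
  T * Rabs (speed b X n T) <= 2 * 2 ^ n * M.
Proof.
intros Hr F HM HE HT.
assert (two : 1 <= 2 ^ n) by (apply pow_R1_Rle; lra).
assert (self : Rabs (X (S n) T + T * speed b X n T) <= 2 ^ n * M).
{ apply (derivative_bound_right (fun l => l * X (S n) (l * T)) _ _ 1).
  - destruct (F n) as [_ [_ d]]; specialize (d T HT).
    replace (X (S n) T + _) with
      (1 * X (S n) (1 * T) + 1 * (T * speed b X n T))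
      by (rewrite !Rmult_1_l; auto).
    apply (is_derive_mult (fun l => l) (fun l => X (S n) (l * T)) 1 1).
    + apply (is_derive_id (K := R_AbsRing)).
    + apply (is_derive_comp (X (S n)) (fun l => l * T)).
      * rewrite Rmult_1_l; exact d.
      * auto_derive; auto; ring.
    + intros; apply Rmult_comm.
  - intros l Hl; rewrite !Rmult_1_l.
    pose (X' := fun n t => l * X n (l * t)).
    assert (F' : flow b X') by (apply flow_rescale; auto; lra).
    assert (init : forall m, energy X' m 0 <= (l * M) ^ 2).
    { intro m; replace (energy X' m 0) with (l ^ 2 * energy X m 0).
      - rewrite Rpow_mult_distr; apply Rmult_le_compat_l; auto.
        apply pow2_ge_0.
      - unfold energy; rewrite scal_sum; apply sum_eq; intros j _.
        unfold X'; rewrite Rmult_0_r; ring. }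
    assert (dist : weighted_dist X' X n T <= ((l - 1) * M) ^ 2).
    { apply (contraction b X' X (l * M) M); auto; try lra.
      - apply Rmult_le_pos; lra.
      - intro m; rewrite Rpow_mult_distr.
        apply Rle_trans with ((l - 1) ^ 2 * energy X m 0);
          [|apply Rmult_le_compat_l; [apply pow2_ge_0 | auto]].
        unfold energy, weighted_dist; rewrite scal_sum; apply sum_Rle.
        intros j _; unfold X'; rewrite Rmult_0_r.
        assert (i : / 2 ^ j <= 1)
          by (rewrite <- Rinv_1; apply Rinv_le_contravar;
              [lra | apply pow_R1_Rle; lra]).
        assert (q := Rmult_le_compat_r _ _ _ (pow2_ge_0 (l * X (S j) 0 - X (S j) 0)) i).
        apply Rle_trans with (1 := q), Req_le; ring. }
    assert (term : / 2 ^ n * (X' (S n) T - X (S n) T) ^ 2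
      <= weighted_dist X' X n T).
    { destruct n as [|m]; [apply Rle_refl|].
      unfold weighted_dist; cbn [sum_f_R0].
      rewrite <- (Rplus_0_l (_ * _)) at 1; apply Rplus_le_compat_r.
      apply cond_pos_sum; intro j.
      apply Rmult_le_pos; [|apply pow2_ge_0].
      left; apply Rinv_0_lt_compat, pow_lt; lra. }
    fold (X' (S n) T).
    rewrite <- (Rabs_right (2 ^ n * M * (l - 1)))
      by (apply Rle_ge; repeat apply Rmult_le_pos; lra).
    apply Rsqr_le_abs_0; rewrite !Rsqr_pow2.
    assert (w : (X' (S n) T - X (S n) T) ^ 2 <= 2 ^ n * ((l - 1) * M) ^ 2).
    { apply Rmult_le_reg_l with (/ 2 ^ n);
        [apply Rinv_0_lt_compat; lra|].
      rewrite <- Rmult_assoc, Rinv_l by lra. lra. }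
    assert (0 <= ((l - 1) * M) ^ 2) by apply pow2_ge_0.
    apply Rle_trans with (1 := w).
    replace ((2 ^ n * M * (l - 1)) ^ 2) with ((2 ^ n) ^ 2 * ((l - 1) * M) ^ 2)
      by ring.
    apply Rmult_le_compat_r; auto; nra. }
destruct (flow_bounded b X M n T F HM HE (Rlt_le _ _ HT)).
rewrite <- (Rabs_right T) at 1 by lra.
rewrite <- Rabs_mult.
replace (T * speed b X n T)
  with (X (S n) T + T * speed b X n T - X (S n) T) by ring.
apply Rle_trans with (1 := Rabs_triang _ _).
rewrite Rabs_Ropp, (Rabs_right (X (S n) T)) by lra.
nra.
Qed.

Lemma power_bound b X M m n T : 1 <= Rpower 2 b -> flow b X -> 0 <= M ->
  (forall n, energy X n 0 <= M ^ 2) -> 0 < T ->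
  Rabs (T * (X (S m) T * speed b X n T)) <= 2 * 2 ^ n * M ^ 2.
Proof.
intros Hr F HM HE HT.
assert (s := speed_bound b X M n T Hr F HM HE HT).
destruct (flow_bounded b X M m T F HM HE (Rlt_le _ _ HT)).
rewrite !Rabs_mult, (Rabs_right T), (Rabs_right (X (S m) T)) by lra.
replace (T * (X (S m) T * Rabs (speed b X n T)))
  with (X (S m) T * (T * Rabs (speed b X n T))) by ring.
replace (2 * 2 ^ n * M ^ 2) with (M * (2 * 2 ^ n * M)) by ring.
apply Rmult_le_compat; auto.
apply Rmult_le_pos; [lra | apply Rabs_pos].
Qed.

(** The energy lost by the shells up to n is their outgoing flux, that is minus
    the sum of X_j X_j'; the bounds on these powers form a geometric series. *)
Lemma flux_bound b X M n T : 1 <= Rpower 2 b -> flow b X -> 0 <= M ->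
  (forall n, energy X n 0 <= M ^ 2) -> 0 < T ->
  T * (k b (S n) * X (S n) T ^ 2 * X (S (S n)) T) <= 4 * 2 ^ n * M ^ 2.
Proof.
intros Hr F HM HE HT.
assert (input := fun m => proj1 (Rabs_le_between _ _) (power_bound b X M m m T Hr F HM HE HT)).
unfold speed in input.
induction n as [|n IH].
- specialize (input 0%nat); change (k b 0) with 0 in input.
  assert (0 <= M ^ 2) by apply pow2_ge_0.
  simpl (2 ^ 0) in *; lra.
- specialize (input (S n)); change (2 ^ S n) with (2 * 2 ^ n) in *; lra.
Qed.

(** This is the equation of the shell above multiplied by X_n. *)
Lemma cubic_bound b X M n T : 1 <= Rpower 2 b -> flow b X -> 0 <= M ->
  (forall n, energy X n 0 <= M ^ 2) -> 0 < T ->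
  T * (k b (S n) * X (S n) T ^ 3) <= 4 * 2 ^ n * M ^ 2 +
    T * (k b (S (S n)) * X (S n) T * X (S (S n)) T * X (S (S (S n))) T).
Proof.
intros Hr F HM HE HT.
assert (h := proj1 (Rabs_le_between _ _) (power_bound b X M n (S n) T Hr F HM HE HT)).
unfold speed in h; change (2 ^ S n) with (2 * 2 ^ n) in h; lra.
Qed.

(** * The pointwise estimate *)

(** The common ratio of the weights k_n^{1/3 - 1/(3 beta)} = rho^n. *)
Definition rho (b : R) : R := Rpower 2 ((b - 1) / 3).

Lemma rho_cube b : Rpower 2 b = 2 * rho b ^ 3.
Proof.
unfold rho; rewrite <- Rpower_pow by apply exp_pos.
rewrite Rpower_mult.
rewrite <- (Rpower_1 2) at 2 by lra.
rewrite <- Rpower_plus; f_equal; simpl; field.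
Qed.

Lemma rho_ge_1 b : 1 <= b -> 1 <= rho b.
Proof.
intro Hb; unfold rho.
rewrite <- (Rpower_O 2) at 1 by lra.
apply Rle_Rpower; lra.
Qed.

Lemma Rpower_k b n : 1 <= b ->
  Rpower (k b (S n)) (1 / 3 - 1 / (3 * b)) = rho b ^ S n.
Proof.
intro Hb; unfold k, rho.
rewrite <- Rpower_pow by apply exp_pos.
rewrite !Rpower_mult; f_equal; field; lra.
Qed.

(** Put Y_n = rho^n X_n.  As k_n = 2^n rho^{3n}, the bounds on flux and cube
    lose all dependence on n:
      t Y_n^2 Y_{n+1} <= 2 rho M^2,
      t Y_n^3 <= 2 M^2 + 2 t Y_n Y_{n+1} Y_{n+2}.
    Multiplying the second by Y_n and inserting the first gives
      t Y_n^4 <= 2 M^2 Y_n + 4 rho M^2 Y_{n+2},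
    so a large Y_n forces Y_{n+2} >= 2 rho^2 Y_n. *)
Lemma two_step_doubling b X M n T : 1 <= b -> flow b X -> 0 < M ->
  (forall n, energy X n 0 <= M ^ 2) -> 0 < T ->
  (2 + 8 * rho b ^ 3) * M ^ 2 < T * (rho b ^ S n * X (S n) T) ^ 3 ->
  2 * X (S n) T <= X (S (S (S n))) T.
Proof.
intros Hb F HM HE HT big.
assert (Hrho := rho_ge_1 b Hb).
assert (rho3 : 1 <= rho b ^ 3) by (apply pow_R1_Rle; auto).
assert (Hr : 1 <= Rpower 2 b) by (rewrite rho_cube; lra).
assert (f := flux_bound b X M n T Hr F (Rlt_le _ _ HM) HE HT).
assert (g := cubic_bound b X M n T Hr F (Rlt_le _ _ HM) HE HT).
assert (x0 := flow_nonneg b X n T F (Rlt_le _ _ HT)).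
assert (x2 := flow_nonneg b X (S (S n)) T F (Rlt_le _ _ HT)).
rewrite k_succ, k_pow in g; rewrite k_pow in f.
rewrite rho_cube, Rpow_mult_distr, <- pow_mult, Nat.mul_comm, pow_mult in f, g.
change (2 ^ S n) with (2 * 2 ^ n) in f, g.
assert (two : 0 < 2 ^ n) by (apply pow_lt; lra).
rewrite Rpow_mult_distr in big.
set (x := X (S n) T) in *; set (y := X (S (S n)) T) in *;
set (z := X (S (S (S n))) T) in *.
set (q := (rho b ^ S n) ^ 3) in *; set (w := rho b ^ 3) in *.
assert (f' : T * q * x ^ 2 * y <= 2 * M ^ 2)
  by (apply Rmult_le_reg_l with (2 * 2 ^ n); lra).
assert (g' : T * q * x ^ 3 <= 2 * M ^ 2 + 2 * w * (T * q * x * y * z))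
  by (apply Rmult_le_reg_l with (2 * 2 ^ n); lra).
assert (m0 : 0 < M ^ 2) by (apply pow_lt; lra).
apply (Rmult_le_compat_l x) in g'; auto.
assert (f2 : 2 * w * z * (T * q * x ^ 2 * y) <= 2 * w * z * (2 * M ^ 2))
  by (apply Rmult_le_compat_l; auto; apply Rmult_le_pos; lra).
assert (b2 := Rmult_le_compat_l x _ _ x0 (Rlt_le _ _ big)).
apply Rmult_le_reg_l with (4 * w * M ^ 2); [apply Rmult_lt_0_compat; lra|].
lra.
Qed.

(** Otherwise the values at every second shell would double forever, whereas
    they are bounded by the norm of the data. *)
Lemma weighted_cube_bound b X M n T : 1 <= b -> flow b X -> 0 < M ->
  (forall n, energy X n 0 <= M ^ 2) -> 0 < T ->
  T * (rho b ^ S n * X (S n) T) ^ 3 <= (2 + 8 * rho b ^ 3) * M ^ 2.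
Proof.
intros Hb F HM HE HT.
destruct (Rle_lt_dec (T * (rho b ^ S n * X (S n) T) ^ 3)
  ((2 + 8 * rho b ^ 3) * M ^ 2)) as [|big]; auto; exfalso.
assert (Hrho := rho_ge_1 b Hb).
assert (x0 := flow_nonneg b X n T F (Rlt_le _ _ HT)).
assert (grow : forall j,
  2 ^ j * X (S n) T <= X (S (n + 2 * j)) T /\
  (2 + 8 * rho b ^ 3) * M ^ 2
    < T * (rho b ^ S (n + 2 * j) * X (S (n + 2 * j)) T) ^ 3).
{ induction j as [|j [IH1 IH2]].
  - rewrite Nat.mul_0_r, Nat.add_0_r; simpl (2 ^ 0); lra.
  - assert (d := two_step_doubling b X M _ T Hb F HM HE HT IH2).
    replace (n + 2 * S j)%nat with (S (S (n + 2 * j))) by lia.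
    split; [simpl pow; lra|].
    apply Rlt_le_trans with (1 := IH2).
    apply Rmult_le_compat_l; [lra|].
    assert (p : 0 <= rho b ^ S (n + 2 * j)) by (apply pow_le; lra).
    assert (xj := flow_nonneg b X (n + 2 * j) T F (Rlt_le _ _ HT)).
    apply pow_incr; split; [now apply Rmult_le_pos|].
    apply Rmult_le_compat; auto; [|lra].
    apply Rle_pow; auto; lia. }
assert (xpos : 0 < X (S n) T).
{ destruct x0 as [|e]; auto; exfalso.
  rewrite <- e in big.
  assert (0 < M ^ 2) by (apply pow_lt; auto).
  assert (1 <= rho b ^ 3) by (apply pow_R1_Rle; auto).
  replace (T * (rho b ^ S n * 0) ^ 3) with 0 in big by ring.
  nra. }
destruct (Pow_x_infinity 2) with (b := (M + 1) / X (S n) T) as [N HN].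
{ rewrite Rabs_right; lra. }
specialize (HN N (le_n _)).
rewrite Rabs_right in HN by (apply Rle_ge, pow_le; lra).
apply Rge_le in HN; apply Rle_div_l in HN; auto.
destruct (grow N) as [g _].
destruct (flow_bounded b X M (n + 2 * N) T F (Rlt_le _ _ HM) HE (Rlt_le _ _ HT)).
lra.
Qed.

(** * Weak solutions *)

Lemma D_in_continuous f d t : D_in f d (fun s => 0 <= s) t -> 0 <= t ->
  continuous (fun s => f (Rmax 0 s)) t.
Proof.
intros D Ht.
apply cont_deriv in D.
apply continuity_pt_filterlim.
intros e He.
destruct (D e He) as [a [Ha H]].
exists a; split; auto.
intros s [_ Hs].
simpl in *; unfold Rdist in *.
rewrite (Rmax_right 0 t) by auto.
destruct (Req_dec (Rmax 0 s) t) as [->|ne].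
- rewrite Rminus_diag, Rabs_R0; auto.
- apply H; split; [split; auto; apply Rmax_l|].
  apply Rle_lt_trans with (2 := Hs).
  unfold Rmax; destruct (Rle_dec 0 s); [lra|].
  rewrite Rabs_minus_sym, (Rabs_minus_sym s), !Rabs_right; lra.
Qed.

Lemma D_in_diff f d :
  (forall t, 0 <= t -> D_in f d (fun s => 0 <= s) t) ->
  diff_from_0 (fun s => f (Rmax 0 s)) d.
Proof.
intro D; split.
- intro t; destruct (Rle_lt_dec 0 t) as [Ht|Ht].
  + apply (D_in_continuous f d); auto.
  + apply (continuous_ext_loc _ (fun _ => f 0)).
    * exists (mkposreal (- t) ltac:(lra)); intros s Hs.
      apply Rabs_lt_between' in Hs; simpl in Hs.
      rewrite Rmax_left; auto; lra.
    * apply continuous_const.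
- intros t Ht.
  apply (is_derive_ext_loc f).
  { exists (mkposreal t Ht); intros s Hs.
    apply Rabs_lt_between' in Hs; simpl in Hs.
    rewrite Rmax_right; auto; lra. }
  apply is_derive_Reals; intros e He.
  destruct (D t (Rlt_le _ _ Ht) e He) as [a [Ha H]].
  assert (m0 : 0 < Rmin a t) by (now apply Rmin_glb_lt).
  exists (mkposreal _ m0); intros h h0 Hh; simpl in Hh.
  assert (ha := Rlt_le_trans _ _ _ Hh (Rmin_l _ _)).
  assert (ht := Rlt_le_trans _ _ _ Hh (Rmin_r _ _)).
  apply Rabs_lt_between in ht.
  specialize (H (t + h)).
  simpl in H; unfold Rdist in H.
  replace (t + h - t) with h in H by ring.
  apply H; split; auto; split; lra.
Qed.

Lemma weak_solution_flow b x X :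
  (forall n, (1 <= n)%nat -> 0 <= x n) -> weak_solution b x X ->
  flow b (fun n t => X n (Rmax 0 t)).
Proof.
intros pos [_ sol] n.
destruct (sol (S n) ltac:(lia)) as [init ode].
split.
- rewrite Rmax_left, init by lra; apply pos; lia.
- generalize (D_in_diff _ _ ode); apply diff_ext; auto.
  intros t Ht; rewrite Rmax_right by lra.
  replace (S n - 1)%nat with n by lia.
  now replace (S n + 1)%nat with (S (S n)) by lia.
Qed.

Lemma l2_norm_energy x n : in_l2 x ->
  sum_f_R0 (fun j => x (S j) ^ 2) n <= l2_norm x ^ 2.
Proof.
intro Hx.
set (a := fun m : nat => x (S m) ^ 2) in *.
assert (bound : forall n, sum_n a n <= Series a).
{ apply is_lim_seq_incr_compare.
  - apply Series_correct, Hx.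
  - intro m; rewrite sum_Sn.
    assert (0 <= a (S m)) by apply pow2_ge_0.
    unfold plus; simpl; lra. }
unfold l2_norm; fold a; rewrite pow2_sqrt.
- rewrite <- sum_n_Reals; apply bound.
- apply Rle_trans with (2 := bound 0%nat).
  rewrite sum_O; apply pow2_ge_0.
Qed.

Lemma le_cube_root y K M t : 0 < K -> 0 < M -> 0 < t ->
  t * y ^ 3 <= K * M ^ 2 ->
  y <= Rpower K (1 / 3) * Rpower M (2 / 3) * Rpower t (- (1 / 3)).
Proof.
intros K0 M0 t0 h.
assert (cube : forall a e, Rpower a e ^ 3 = Rpower a (e * 3)).
{ intros a e; rewrite <- Rpower_pow by apply exp_pos.
  rewrite Rpower_mult; f_equal; simpl; ring. }
set (B := Rpower K (1 / 3) * Rpower M (2 / 3) * Rpower t (- (1 / 3))).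
assert (B0 : 0 < B) by (unfold B; repeat apply Rmult_lt_0_compat; apply exp_pos).
assert (e : t * B ^ 3 = K * M ^ 2).
{ unfold B; rewrite !Rpow_mult_distr, !cube.
  replace (1 / 3 * 3) with 1 by field.
  replace (2 / 3 * 3) with (INR 2) by (simpl; field).
  replace (- (1 / 3) * 3) with (- (1)) by field.
  rewrite Rpower_Ropp, !Rpower_1, Rpower_pow by auto.
  field; lra. }
destruct (Rle_lt_dec y B) as [|lt]; auto; exfalso.
assert (0 < (y - B) * (y ^ 2 + y * B + B ^ 2)) by (apply Rmult_lt_0_compat; nra).
assert (B ^ 3 < y ^ 3) by lra.
nra.
Qed.

Theorem theorem17 :
  forall beta : R, 1 <= beta ->
  exists c : R, 0 < c /\
    forall (x : nat -> R) (X : nat -> R -> R),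
      in_l2 x ->
      (forall n : nat, (1 <= n)%nat -> 0 <= x n) ->
      weak_solution beta x X ->
      forall t : R, 0 < t ->
        Rbar_le
          (Sup_seq (fun m : nat =>
             Finite (Rpower (k beta (S m)) (1 / 3 - 1 / (3 * beta)) * X (S m) t)))
          (Finite (c * rpow (l2_norm x) (2 / 3) * Rpower t (- (1 / 3)))).
Proof.
intros b Hb.
assert (Hrho := rho_ge_1 b Hb).
assert (rho3 : 1 <= rho b ^ 3) by (apply pow_R1_Rle; auto).
exists (Rpower (2 + 8 * rho b ^ 3) (1 / 3)); split; [apply exp_pos|].
intros x X Hx pos sol t Ht.
apply Rbar_not_lt_le; intro lt.
apply Sup_seq_minor_lt in lt; destruct lt as [n lt].
apply (Rlt_not_le _ _ lt); clear lt.
rewrite Rpower_k by auto.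
assert (F := weak_solution_flow b x X pos sol).
assert (HM : 0 <= l2_norm x) by apply sqrt_pos.
assert (HE : forall m, energy (fun n t => X n (Rmax 0 t)) m 0 <= l2_norm x ^ 2).
{ intro m; apply Rle_trans with (2 := l2_norm_energy x m Hx).
  apply Req_le; unfold energy; apply sum_eq; intros j _.
  destruct sol as [_ sol]; destruct (sol (S j) ltac:(lia)) as [init _].
  rewrite Rmax_left, init by lra; reflexivity. }
unfold rpow; destruct (Req_EM_T (l2_norm x) 0) as [e|ne].
- assert (h := flow_bounded b _ _ n t F HM HE (Rlt_le _ _ Ht)); cbv beta in h.
  rewrite Rmax_right, e in h by lra.
  replace (X (S n) t) with 0 by lra.
  lra.
- assert (M0 : 0 < l2_norm x) by lra.
  apply le_cube_root; auto; [lra|].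
  assert (h := weighted_cube_bound b _ _ n t Hb F M0 HE Ht); cbv beta in h.
  now rewrite Rmax_right in h by lra.
Qed.
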